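(* Let $T>0$, $N_t\in\mathbb{N}^*$, $\Delta t=T/N_t$, and let $\Delta t>0$, $\Delta x>0$ and $\Delta v>0$ be fixed. Let $\varphi_{\mathrm{in}}:\mathbb{R}\times\mathbb{R}\to\mathbb{R}$ be independent of $\varepsilon$ and, with $\mu_{\mathrm{in},i}=\min_{j\in\mathbb{Z}}\overline{\varphi}_{\mathrm{in},i_j,j}$, assume that there exist $M>0$ and $L\ge 0$ such that (a) $\left|\varphi_{\mathrm{in}}(x,v)-\frac{v^2}{2}\right|\le M$ for all $(x,v)\in\mathbb{R}^2$; (b) $\left|\mu_{\mathrm{in},i}+\varepsilon\ln(c^\varepsilon_{\Delta v})\right|\le M$ for all $i\in\mathbb{Z}$ and all $\varepsilon\in(0,1]$; (c) for all $v\in\mathbb{R}$, the function $x\mapsto\varphi_{\mathrm{in}}(x,v)-\frac{v^2}{2}$ is $L$-Lipschitz. For $\varepsilon\in(0,1]$ let $(\mu_i^{\varepsilon,n},\varphi_{ij}^{\varepsilon,n})$ be the solution of the fully discrete scheme $(\mathcal{S}^\varepsilon)$ (defined in the context) with $\mu_i^{\varepsilon,0}=\mu_{\mathrm{in},i}$ and $\varphi_{ij}^{\varepsilon,0}=\varphi_{\mathrm{in}}(x_i,v_j)$ for all $(i,j)\in\mathbb{Z}^2$. Then, in the limit $\varepsilon\to0$, for every $n\in\{1,\dots,N_t\}$ and $j\in\mathbb{Z}$, $(\mu_i^{\varepsilon,n},\varphi_{ij}^{\varepsilon,n})$ converges, locally uniformly in $i\in\mathbb{Z}$, towards $(\mu_i^n,\varphi_{ij}^n)$,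 the solution of $$\mu_i^{n+1}=\min_{j\in\mathbb{Z}}\overline{\varphi}^{\,n}_{i_j,j},\qquad \varphi_{ij}^{n+1}=\min\left\{\overline{\varphi}^{\,n}_{i_j,j}+\Delta t,\ \frac{v_j^2}{2}+\mu_i^{n+1}\right\},\qquad (i,j)\in\mathbb{Z}^2,\ 0\le n\le N_t-1,$$ with initial data $\mu_i^0=\mu_{\mathrm{in},i}$ and $\varphi_{ij}^0=\varphi_{\mathrm{in}}(x_i,v_j)$. In addition, the numerical cost of the scheme $(\mathcal{S}^\varepsilon)$ is independent of $\varepsilon$.
   Context: Grid: $x_i=i\Delta x$, $v_j=j\Delta v$ for $i,j\in\mathbb{Z}$; $t^n=n\Delta t$. Linear interpolation: for a family $u=(u_{ij})_{(i,j)\in\mathbb{Z}^2}$, set $\beta_j=\lfloor v_j\Delta t/\Delta x\rfloor$, $\alpha_j=v_j\Delta t/\Delta x-\beta_j\in[0,1)$, $i_j=i-\beta_j$, and $$\overline{u}_{i_j,j}=(1-\alpha_j)\,u_{i_j,j}+\alpha_j\,u_{i_j-1,j},$$ which is the linear interpolation of $(u_{ij})_i$ at the point $x_i-\Delta t\,v_j$. $\overline{\varphi}_{\mathrm{in},i_j,j}$ is this interpolation applied to $(\varphi_{\mathrm{in}}(x_i,v_j))_{ij}$, $\overline{\varphi}^{\,\varepsilon,n}_{i_j,j}$ to $(\varphi^{\varepsilon,n}_{ij})_{ij}$, and $\overline{\varphi}^{\,n}_{i_j,j}$ to $(\varphi^{n}_{ij})_{ij}$. Discrete velocity integral: $\langle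 u\rangle_{\Delta v}=\sum_{j\in\mathbb{Z}}u_j\,\Delta v$, and $c^\varepsilon_{\Delta v}=\sum_{j\in\mathbb{Z}}e^{-v_j^2/(2\varepsilon)}\Delta v$. Scheme $(\mathcal{S}^\varepsilon)$: for $(i,j)\in\mathbb{Z}^2$ and $0\le n\le N_t-1$, with $$m_i^{\varepsilon,n}=\min_{j\in\mathbb{Z}}\overline{\varphi}^{\,\varepsilon,n}_{i_j,j},\qquad M_{ij}^{\varepsilon,n}=\min\left\{\overline{\varphi}^{\,\varepsilon,n}_{i_j,j}+\Delta t,\ \frac{v_j^2}{2}+\mu_i^{\varepsilon,n+1}\right\},$$ $$\mu_i^{\varepsilon,n+1}=m_i^{\varepsilon,n}-\varepsilon\ln\left(\left\langle e^{-[\overline{\varphi}^{\,\varepsilon,n}_{i_j,j}-m_i^{\varepsilon,n}]/\varepsilon}\right\rangle_{\Delta v}\right),$$ $$\varphi_{ij}^{\varepsilon,n+1}=M_{ij}^{\varepsilon,n}-\varepsilon\ln\left(c^\varepsilon_{\Delta v}\,e^{-[\overline{\varphi}^{\,\varepsilon,n}_{i_j,j}+\Delta t-M_{ij}^{\varepsilon,n}]/\varepsilon}+(1-e^{-\Delta t/\varepsilon})\,e^{-[\frac{v_j^2}{2}+\mu_i^{\varepsilon,n+1}-M_{ij}^{\varepsilon,n}]/\varepsilon}\right)+\varepsilon\ln(c^\varepsilon_{\Delta v}).$$ Numerical cost: the cost of solving $(\mathcal{S}^\varepsilon)$. Its independence of $\varepsilon$ is understood in the sense that the resolution is an explicit procedure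 ($\mu_i^{\varepsilon,n+1}$ is computed explicitly from $\varphi^{\varepsilon,n}$, then $\varphi_{ij}^{\varepsilon,n+1}$ explicitly from $\varphi^{\varepsilon,n}$ and $\mu_i^{\varepsilon,n+1}$) and that the discretization parameters $\Delta t,\Delta x,\Delta v$ can be chosen independently of $\varepsilon$. *)

(* Defs.v *)
From HB Require Import structures.
From mathcomp Require Import all_boot all_order all_algebra.
From mathcomp Require Import all_classical all_reals all_analysis.

Set Implicit Arguments.
Unset Strict Implicit.
Unset Printing Implicit Defensive.

Import Order.TTheory GRing.Theory Num.Theory.
Import numFieldNormedType.Exports.

Local Open Scope classical_set_scope.
Local Open Scope ring_scope.

Section Grid.
Variable R : realType.

Definition is_min (u : int -> R) (m : R) : Prop :=
  (exists j, u j = m) /\ forall j, m <= u j.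

(* Grid points x_i = i dx and v_j = j dv. *)
Definition node (h : R) (k : int) : R := k%:~R * h.

Definition beta (dt dx dv : R) (j : int) : int :=
  Num.floor (node dv j * dt / dx).

Definition alpha (dt dx dv : R) (j : int) : R :=
  node dv j * dt / dx - (beta dt dx dv j)%:~R.

(* Linear interpolation of (u_ij)_i at x_i - dt v_j; i - beta_j is the
   index written i_j in the scheme. *)
Definition interp (dt dx dv : R) (u : int -> int -> R) (i j : int) : R :=
  (1 - alpha dt dx dv j) * u (i - beta dt dx dv j) j
  + alpha dt dx dv j * u (i - beta dt dx dv j - 1) j.

(* <u>_dv, for nonnegative u. The value is only meaningful when the series
   converges; eps_solution requires it. *)
Definition vint (dv : R) (u : int -> R) : R :=
  fine (\esum_(j in [set: int]) (u j * dv)%:E).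

Definition c_dv (dv eps : R) : R :=
  vint dv (fun j => expR (- (node dv j ^+ 2 / (2 * eps)))).

Definition sampled (dx dv : R) (f : R -> R -> R) (i j : int) : R :=
  f (node dx i) (node dv j).

(* (mu, phi) solves (S^eps) on 0 <= n <= Nt. *)
Definition eps_solution (Nt : nat) (dt dx dv : R) (phi_in : R -> R -> R)
    (mu_in : int -> R) (eps : R)
    (mu : nat -> int -> R) (phi : nat -> int -> int -> R) : Prop :=
  [/\ forall i, mu 0 i = mu_in i,
      forall i j, phi 0 i j = sampled dx dv phi_in i j &
      forall (n : nat) (i : int), (n < Nt)%N ->
        let ph j := interp dt dx dv (phi n) i j in
        let c := c_dv dv eps in
        exists m : R,
          let g j := expR (- (ph j - m) / eps) in
          [/\ is_min ph m,
              summable [set: int] (fun j => (g j * dv)%:E),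
              mu n.+1 i = m - eps * ln (vint dv g) &
              forall j,
                let w := node dv j ^+ 2 / 2 + mu n.+1 i in
                let M := Num.min (ph j + dt) w in
                phi n.+1 i j =
                  M - eps * ln (c * expR (- (ph j + dt - M) / eps)
                                + (1 - expR (- dt / eps))
                                  * expR (- (w - M) / eps))
                  + eps * ln c]].

Definition limit_solution (Nt : nat) (dt dx dv : R) (phi_in : R -> R -> R)
    (mu_in : int -> R)
    (mu : nat -> int -> R) (phi : nat -> int -> int -> R) : Prop :=
  [/\ forall i, mu 0 i = mu_in i,
      forall i j, phi 0 i j = sampled dx dv phi_in i j &
      forall (n : nat) (i : int), (n < Nt)%N ->
        is_min (interp dt dx dv (phi n) i) (mu n.+1 i) /\
        forall j, phi n.+1 i j =
          Num.min (interp dt dx dv (phi n) i j + dt)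
                  (node dv j ^+ 2 / 2 + mu n.+1 i)].

(* Locally uniform convergence on the discrete set of indices, as eps -> 0+:
   every compact subset of int lies in some interval [a, b]. *)
Definition cvg_locally_uniformly (u : R -> int -> R) (l : int -> R) : Prop :=
  forall a b : int,
    {uniform [set i | a <= i <= b], u eps @[eps --> 0^'+] --> l}.

End Grid.

(* Procedures that may be run at a grid point. The syntax contains no real
   number: eps and the discretization parameters are run-time inputs. *)
Inductive expr : Type :=
| Lit of nat
| Var of nat                    (* de Bruijn index *)
| Eps
| TimeStep
| Vel                           (* v_j *)
| Frac                          (* alpha_j *)
| Foot                          (* phi^n at (i_j, j) *)
| FootL                         (* phi^n at (i_j - 1, j) *)
| OpAdd of expr & expr
| OpSub of expr & expr
| OpMul of expr & expr
| OpDiv of expr & expr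
| OpMin of expr & expr
| OpExp of expr
| OpLn of expr
| MinV of expr                  (* minimum over all j, binds j *)
| SumV of expr                  (* < . >_dv, binds j *)
| Let of expr & expr            (* the first result is Var 0 in the second *)
| Iter of expr & expr & expr.
(* Iter k b a iterates b, in which Var 0 is the current value, from a. The
   number of iterations is the integer part of the value of k, so that the cost
   of a procedure in general depends on its data: an implicit solver or a time
   sub-cycling with O(1/eps) steps has an eps-dependent cost. *)

Fixpoint loop_free (e : expr) : bool :=
  match e with
  | OpAdd a b | OpSub a b | OpMul a b | OpDiv a b | OpMin a b | Let a b =>
      loop_free a && loop_free b
  | OpExp a | OpLn a | MinV a | SumV a => loop_free a
  | Iter _ _ _ => false
  | _ => true
  end.

Section Run.
Variables (R : realType) (dt dx dv eps : R) (u : int -> int -> R) (i : int).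

Fixpoint run (e : expr) (j : int) (s : seq R) : R :=
  match e with
  | Lit k => k%:R
  | Var k => nth 0 s k
  | Eps => eps
  | TimeStep => dt
  | Vel => node dv j
  | Frac => alpha dt dx dv j
  | Foot => u (i - beta dt dx dv j) j
  | FootL => u (i - beta dt dx dv j - 1) j
  | OpAdd a b => run a j s + run b j s
  | OpSub a b => run a j s - run b j s
  | OpMul a b => run a j s * run b j s
  | OpDiv a b => run a j s / run b j s
  | OpMin a b => Num.min (run a j s) (run b j s)
  | OpExp a => expR (run a j s)
  | OpLn a => ln (run a j s)
  | MinV a => inf (range (fun k => run a k s))
  | SumV a => vint dv (fun k => run a k s)
  | Let a b => run b j (run a j s :: s)
  | Iter k b a => iter (Num.truncn (run k j s))
                       (fun r => run b j (r :: s)) (run a j s)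
  end.

(* Number of elementary operations. The grid is infinite, so a reduction over
   the velocities is charged for the nodes of a finite window J. *)
Fixpoint run_cost (J : seq int) (e : expr) (j : int) (s : seq R) : nat :=
  match e with
  | OpAdd a b | OpSub a b | OpMul a b | OpDiv a b | OpMin a b =>
      (run_cost J a j s + run_cost J b j s).+1
  | OpExp a | OpLn a => (run_cost J a j s).+1
  | MinV a | SumV a => (\sum_(k <- J) (run_cost J a k s).+1)%N
  | Let a b => (run_cost J a j s + run_cost J b j (run a j s :: s)).+1
  | Iter k b a =>
      (run_cost J k j s + run_cost J a j s
       + \sum_(m < Num.truncn (run k j s))
           run_cost J b j
             (iter m (fun r => run b j (r :: s)) (run a j s) :: s)).+1
  | _ => 1
  end.

End Run.

(* An explicit time step: upd_mu computes mu^{n+1}_i from phi^n only, then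
   upd_phi computes phi^{n+1}_ij from phi^n and mu^{n+1}_i (its Var 0). *)
Record procedure := Procedure { upd_mu : expr; upd_phi : expr }.

Definition explicit_procedure (p : procedure) : bool :=
  loop_free (upd_mu p) && loop_free (upd_phi p).

Section Solve.
Variables (R : realType) (p : procedure) (Nt : nat) (dt dx dv eps : R).
Variables (mu : nat -> int -> R) (phi : nat -> int -> int -> R).

(* upd_mu is run outside any velocity index; the 0 is a dummy. *)
Definition computes : Prop :=
  forall (n : nat) (i : int), (n < Nt)%N ->
    mu n.+1 i = run dt dx dv eps (phi n) i (upd_mu p) 0 [::] /\
    forall j, phi n.+1 i j =
      run dt dx dv eps (phi n) i (upd_phi p) j [:: mu n.+1 i].

(* Cost of the Nt steps for the space nodes in I and velocity nodes in J. *)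
Definition total_cost (I J : seq int) : nat :=
  (\sum_(n < Nt) \sum_(i <- I)
     (run_cost dt dx dv eps (phi n) i J (upd_mu p) 0 [::]
      + \sum_(j <- J)
          run_cost dt dx dv eps (phi n) i J (upd_phi p) j [:: mu n.+1 i]))%N.

End Solve.

(* Main.v *)
Require Import Defs.
From HB Require Import structures.
From mathcomp Require Import all_boot all_order all_algebra.
From mathcomp Require Import all_classical all_reals all_analysis.
From mathcomp Require Import lra zify ring.

Set Implicit Arguments.
Unset Strict Implicit.
Unset Printing Implicit Defensive.

Import Order.TTheory GRing.Theory Num.Theory.
Import numFieldNormedType.Exports.

Local Open Scope classical_set_scope.
Local Open Scope ring_scope.

(** The exponential weights of the scheme are controlled uniformly in eps, so
every logarithm in it stays bounded and is killed by its factor eps.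

Call a velocity profile f kinetic with constant B when |f_j - v_j^2/2| <= B for
all j. Interpolation is a convex combination over space indices that share the
same velocity, hence it keeps this bound ([interp_kinetic]), and a kinetic
profile grows quadratically in j, hence attains its minimum on the grid
([kinetic_min]).

For a kinetic profile with minimum m and eps <= 1, every Gibbs weight
exp(-(f_j - m)/eps) is at most exp(-(f_j - m)) because its exponent is
nonpositive, and this dominates it by a summable sequence that does not involve
eps. The node where m is attained has weight 1 and contributes dv. The
discrete integral that defines mu is therefore caught between two positive
constants ([weights_itv]), and so is the Gaussian mass c ([c_dv_itv]).
In the formula for phi, subtracting the minimum M makes one of the two
exponentials equal to 1, while the weights c and 1 - exp(-dt/eps) are bounded
below by dv and 1 - exp(-dt) ([softmin_arg_itv]). Consequently one step of the
scheme differs from one step of the limit scheme, applied to the same data, by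
at most K eps, uniformly in space and velocity ([eps_step_near_min], where phi
is compared with the minimum that involves its own mu).

Interpolation, minimum over the velocities and minimum of two numbers are all
1-Lipschitz for the supremum norm, so the errors of successive steps merely add
up ([step_dist]): after n steps the two solutions are at distance at most
K_n eps over the whole grid ([eps_limit_dist]), which is stronger than locally
uniform convergence. The same bounds keep the iterates kinetic, so that every
minimum and series met along the way exists; this gives the solutions.

For the cost, the formulas of the scheme are written as a loop-free program
([scheme_procedure]); the cost of such a program depends on its syntax and on
the number of velocity nodes only ([run_cost_loop_free]). *)

(** * Discrete velocity integrals *)

Section Velocities.
Variable R : realType.
Implicit Types (dv : R) (f g : int -> R).

Lemma absz_le_sqr (k : int) : (`|k|%N)%:R <= (k%:~R : R) ^+ 2.
Proof.
rewrite -real_normK ?num_real// -intr_norm -natr_absz -natrX ler_nat.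
by case: `|k|%N => // n; rewrite expnS leq_pmulr// expn1.
Qed.

(** The dominating sequence: geometric in |k|, which avoids comparing Gaussian
sums, with the ratio exp(-dv^2/2) coming from k^2 >= |k|. *)
Definition expdecay dv (K : R) (k : int) : R :=
  K * expR (- (dv ^+ 2 / 2)) ^+ `|k|%N.

Lemma expdecay_ge0 dv K k : 0 <= K -> 0 <= expdecay dv K k.
Proof. by move=> K0; rewrite mulr_ge0// exprn_ge0// expR_ge0. Qed.

Lemma gauss_le_expdecay dv k :
  expR (- (node dv k ^+ 2 / 2)) <= expR (- (dv ^+ 2 / 2)) ^+ `|k|%N.
Proof.
rewrite -expRM_natl ler_expR mulrN lerN2 mulrA ler_pM2r// exprMn.
by rewrite ler_wpM2r ?sqr_ge0// absz_le_sqr.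
Qed.

Lemma nneseries_geometric_lty (a : nat -> \bar R) (K q : R) :
  0 <= K -> 0 < q < 1 ->
  (forall n, 0 <= a n)%E -> (forall n, a n <= (K * q ^+ n)%:E)%E ->
  (\sum_(0 <= n <oo) a n < +oo)%E.
Proof.
move=> K0 /andP[q0 q1] a0 aq.
apply: (@le_lt_trans _ _ (K * (1 - q)^-1)%:E); last exact: ltry.
apply: lime_le; first exact: is_cvg_nneseries.
apply: nearW => n.
apply: (@le_trans _ _ (\sum_(0 <= k < n) (K * q ^+ k)%:E)%E).
  exact: lee_sum.
rewrite sumEFin lee_fin; apply: geometric_le_lim => //.
by rewrite gtr0_norm.
Qed.

Lemma esum_expdecay_lty dv (K : R) : 0 < dv -> 0 <= K ->
  (\esum_(k in [set: int]) (expdecay dv K k * dv)%:E < +oo)%E.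
Proof.
move=> dv0 K0.
have f0 k : (0 <= (expdecay dv K k * dv)%:E)%E.
  by rewrite lee_fin mulr_ge0 ?expdecay_ge0// ltW.
have q01 : 0 < expR (- (dv ^+ 2 / 2)) < 1.
  rewrite expR_gt0 expR_lt1 oppr_lt0.
  by rewrite divr_gt0// exprn_gt0.
(* Each of the two half-lines, the ranges of Posz and Negz, is summed along
   its enumeration by the naturals, where the series is geometric. *)
have half (e : nat -> int) : injective e ->
    (forall n, n <= `|e n|)%N ->
    (\esum_(k in range e) (expdecay dv K k * dv)%:E < +oo)%E.
  move=> einj ele.
  rewrite esum_image; last by move=> ? ? _ _; exact: einj.
  rewrite -nneseries_esumT//.
  apply: (@nneseries_geometric_lty _ (K * dv) _ _ q01) => //.
    by rewrite mulr_ge0// ltW.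
  move=> n; rewrite lee_fin /expdecay mulrAC.
  rewrite ler_wpM2l ?(mulr_ge0 K0 (ltW dv0))//.
  case/andP: q01 => q0 q1; apply: ler_wiXn2l => //; exact: ltW.
rewrite (esumID (range Posz))//; apply: lte_add_pinfty.
  by rewrite setTI; apply: half => // ? ? [].
have -> : [set: int] `&` ~` range Posz = range Negz.
  apply/seteqP; split => [[n|n] [_ nP]|_ [n _ <-]].
  - by exfalso; apply: nP; exists n.
  - by exists n.
  - by split=> // -[].
by apply: half => [? ? []|n] //; exact: leqnSn.
Qed.

(** Domination is what turns finiteness of an eps-free series into both the
summability required by the scheme and an eps-free upper bound. *)
Lemma vint_le dv f g : 0 < dv -> (forall k, 0 <= f k <= g k) ->
  (\esum_(k in [set: int]) (g k * dv)%:E < +oo)%E ->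
  summable [set: int] (fun k => (f k * dv)%:E) /\ vint dv f <= vint dv g.
Proof.
move=> dv0 fg gfin.
have f0 k : (0 <= (f k * dv)%:E)%E.
  by have /andP[? _] := fg k; rewrite lee_fin mulr_ge0// ltW.
have fgE : (\esum_(k in [set: int]) (f k * dv)%:E <=
            \esum_(k in [set: int]) (g k * dv)%:E)%E.
  apply: le_esum => k _; rewrite lee_fin ler_pM2r//.
  by have /andP[] := fg k.
have ffin := le_lt_trans fgE gfin.
split.
  by rewrite /summable; under eq_esum do rewrite gee0_abs//.
apply: fine_le => //; rewrite ge0_fin_numE//; apply: esum_ge0 => k _ //.
have /andP[h1 h2] := fg k.
by rewrite lee_fin mulr_ge0 ?(ltW dv0)// (le_trans h1).
Qed.

Lemma vint_ge_node dv f k : 0 < dv -> (forall k', 0 <= f k') ->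
  summable [set: int] (fun k => (f k * dv)%:E) -> f k * dv <= vint dv f.
Proof.
move=> dv0 f0 sf; have f0' k' : (0 <= (f k' * dv)%:E)%E.
  by rewrite lee_fin mulr_ge0// ltW.
have ffin : (\esum_(k in [set: int]) (f k * dv)%:E < +oo)%E.
  by move: sf; rewrite /summable; under eq_esum do rewrite gee0_abs//.
rewrite -lee_fin /vint fineK; last by rewrite ge0_fin_numE// esum_ge0.
apply: esum_ge; exists [set k] => //.
by rewrite fsbig_set1.
Qed.

End Velocities.

(** * Interpolation and minima over the velocities *)

Section Interpolation.
Variable R : realType.
Implicit Types (dt dx dv B d : R) (u w : int -> int -> R) (f g : int -> R).

Lemma alpha_itv dt dx dv j : 0 <= alpha dt dx dv j <= 1.
Proof.
have /andP[] := floor_itv (node dv j * dt / dx).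
rewrite /alpha /beta intrD mulr1z => h1 h2; apply/andP; split; lra.
Qed.

(** Interpolation is a convex combination, since alpha lies in [0, 1]. *)
Lemma norm_interp dt dx dv u i j d :
  (forall i', `|u i' j| <= d) -> `|interp dt dx dv u i j| <= d.
Proof.
move=> ud; have /andP[a0 a1] := alpha_itv dt dx dv j; rewrite /interp.
set a := alpha _ _ _ _ in a0 a1 *.
have b0 : 0 <= 1 - a by lra.
have := ud (i - beta dt dx dv j); have := ud (i - beta dt dx dv j - 1).
move=> h1 h2; apply: (le_trans (ler_normD _ _)).
rewrite !normrM (ger0_norm b0) (ger0_norm a0).
have -> : d = (1 - a) * d + a * d by ring.
by apply: lerD; apply: ler_wpM2l.
Qed.

Lemma interpB dt dx dv u w i j :
  interp dt dx dv (fun i' j' => u i' j' - w i' j') i j =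
  interp dt dx dv u i j - interp dt dx dv w i j.
Proof. by rewrite /interp; ring. Qed.

Lemma interp_cst dt dx dv f i j :
  interp dt dx dv (fun=> f) i j = f j.
Proof. by rewrite /interp; ring. Qed.

(** The class of profiles preserved by both schemes. The constant bounds the
distance to the Maxwellian phase v^2/2, hence also the minimum. *)
Definition kinetic dv B f := forall j, `|f j - node dv j ^+ 2 / 2| <= B.

Lemma interp_kinetic dt dx dv B u i :
  (forall i', kinetic dv B (u i')) -> kinetic dv B (interp dt dx dv u i).
Proof.
move=> uB j.
have := interpB dt dx dv u (fun _ k => node dv k ^+ 2 / 2) i j.
rewrite (interp_cst _ _ _ (fun k => node dv k ^+ 2 / 2)) => <-.
by apply: norm_interp => i'; exact: uB.
Qed.

Lemma interp_dist dt dx dv u w d i j :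
  (forall i' j', `|u i' j' - w i' j'| <= d) ->
  `|interp dt dx dv u i j - interp dt dx dv w i j| <= d.
Proof. by move=> uwd; rewrite -interpB; apply: norm_interp. Qed.

Lemma min_dist (x y x' y' d : R) : `|x - x'| <= d -> `|y - y'| <= d ->
  `|Num.min x y - Num.min x' y'| <= d.
Proof.
rewrite !ler_norml => /andP[h1 h2] /andP[h3 h4].
by case: (leP x y) => h5; case: (leP x' y') => h6; apply/andP; split; lra.
Qed.

Lemma is_min_dist f g m m' d : is_min f m -> is_min g m' ->
  (forall j, `|f j - g j| <= d) -> `|m - m'| <= d.
Proof.
move=> [[j fj] mP] [[k gk] m'P] fg.
have := fg j; have := fg k; rewrite !ler_norml => /andP[h1 h2] /andP[h3 h4].
by have := mP k; have := m'P j => h5 h6; apply/andP; split; lra.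
Qed.

Lemma is_min_inf f m : is_min f m -> inf (range f) = m.
Proof.
move=> [[j <-] mP]; have lbf : lbound (range f) (f j) by move=> _ [k _ <-].
apply/eqP; rewrite eq_le; apply/andP; split.
  by apply: ge_inf; [exists (f j)|exists j].
by apply: lb_le_inf => //; exists (f j), j.
Qed.

Lemma window_min f (N : nat) :
  exists j, forall k : int, (`|k| <= N)%N -> f j <= f k.
Proof.
elim: N => [|N [j jP]].
  by exists 0 => k; rewrite leqn0 absz_eq0 => /eqP ->.
have [l lP] : exists l, [/\ f l <= f j, f l <= f (Posz N.+1) &
    f l <= f (- (Posz N.+1))].
  case: (leP (f j) (f (Posz N.+1))) => h1.
    case: (leP (f j) (f (- (Posz N.+1)))) => h2; first by exists j.
    by exists (- Posz N.+1); split=> //; lra.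
  case: (leP (f (Posz N.+1)) (f (- (Posz N.+1)))) => h2.
    by exists (Posz N.+1); split=> //; lra.
  by exists (- Posz N.+1); split=> //; lra.
exists l => k kN; case: lP => l1 l2 l3.
have [kN1|] := leqP `|k| N; first exact: le_trans (jP k kN1).
move=> kN1; have [->|->] : k = Posz N.+1 \/ k = - Posz N.+1 by lia.
  by [].
by [].
Qed.

(** Outside a finite window, quadratic growth pushes f above its value at 0, so
a minimum over the window is a global one. *)
Lemma kinetic_min dv B f : 0 < dv -> kinetic dv B f -> exists m, is_min f m.
Proof.
move=> dv0 fB; pose r := 2 * (f 0 + B) / dv ^+ 2.
pose N := (Num.truncn r).+1.
have dv20 : 0 < dv ^+ 2 by rewrite exprn_gt0.
have [j jP] := window_min f N; exists (f j); split; first by exists j.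
move=> k; have [/jP//|Nk] := leqP `|k| N.
apply: le_trans (jP 0 _) _; first by rewrite absz0.
(* |k| > r gives k^2 dv^2 >= 2 (f 0 + B), that is v_k^2/2 - B >= f 0. *)
have rk : r <= (node dv k ^+ 2) / dv ^+ 2.
  rewrite exprMn mulfK ?gt_eqF//; apply: le_trans (absz_le_sqr _ _).
  apply: le_trans (_ : N%:R <= _); last by rewrite ler_nat ltnW.
  by apply: ltW; exact: truncnS_gt.
move: rk; rewrite ler_pM2r ?invr_gt0// => rk.
have := fB k; rewrite ler_norml => /andP[h1 h2]; lra.
Qed.

Lemma kinetic_min_bound dv B f m : kinetic dv B f -> is_min f m -> `|m| <= B.
Proof.
move=> fB [[j <-] mP]; have := mP 0; have := fB 0; have := fB j.
rewrite [node dv 0]mul0r expr0n mul0r subr0 !ler_norml.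
have := sqr_ge0 (node dv j) => h0 /andP[h1 h2] /andP[h3 h4] h5.
by apply/andP; split; lra.
Qed.

Lemma min_kinetic dv B f g : kinetic dv B f -> kinetic dv B g ->
  kinetic dv B (fun j => Num.min (f j) (g j)).
Proof. by move=> fB gB j; have := min_dist (fB j) (gB j); rewrite minxx. Qed.

End Interpolation.

(** * Logarithms of Gibbs weights *)

Section LogSumExp.
Variable R : realType.
Implicit Types (dv eps : R) (f : int -> R).

Lemma norm_ln_le (lo hi x : R) : 0 < lo -> lo <= x <= hi ->
  `|ln x| <= `|ln lo| + `|ln hi|.
Proof.
move=> lo0 /andP[lox xhi]; have x0 := lt_le_trans lo0 lox.
have hi0 := lt_le_trans x0 xhi.
have h1 : ln lo <= ln x by rewrite ler_ln ?posrE.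
have h2 : ln x <= ln hi by rewrite ler_ln ?posrE.
have := ler_norm (- ln lo); rewrite normrN => h3.
have := ler_norm (ln hi) => h4.
have := normr_ge0 (ln lo) => h5; have := normr_ge0 (ln hi) => h6.
by rewrite ler_norml; apply/andP; split; lra.
Qed.

Lemma exp_scaled_le eps (x : R) : 0 < eps <= 1 -> 0 <= x ->
  expR (- x / eps) <= expR (- x).
Proof.
move=> /andP[e0 e1] x0; rewrite ler_expR mulNr lerN2 ler_peMr//.
by rewrite invf_ge1.
Qed.

(** The node j = 0 alone contributes dv; the rest is dominated by the case
eps = 1. *)
Lemma c_dv_itv dv eps : 0 < dv -> 0 < eps <= 1 ->
  dv <= c_dv dv eps <= vint dv (expdecay dv 1).
Proof.
move=> dv0 e01; have /andP[e0 e1] := e01.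
have [] := @vint_le _ dv (fun j => expR (- (node dv j ^+ 2 / (2 * eps))))
  (expdecay dv 1) dv0.
- move=> k; rewrite expR_ge0/= /expdecay mul1r.
  apply: le_trans (gauss_le_expdecay dv k).
  rewrite invfM mulrA -mulNr; apply: exp_scaled_le => //.
  by rewrite mulr_ge0 ?sqr_ge0.
- exact: esum_expdecay_lty.
move=> sm le1; rewrite le1 andbT.
have := vint_ge_node 0 dv0 _ sm.
rewrite [node dv 0]mul0r expr0n mul0r oppr0 expR0 mul1r; apply => k.
exact: expR_ge0.
Qed.

(** Since f_j - m >= 0 and eps <= 1, the weight is at most exp(-(f_j - m)), and
f_j - m >= v_j^2/2 - 2 B because m <= B. The lower bound dv is the
contribution of a node where f is minimal. *)
Lemma weights_itv dv eps B f m : 0 < dv -> 0 < eps <= 1 ->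
  kinetic dv B f -> is_min f m ->
  let g j := expR (- (f j - m) / eps) in
  summable [set: int] (fun j => (g j * dv)%:E) /\
  dv <= vint dv g <= vint dv (expdecay dv (expR (2 * B))).
Proof.
move=> dv0 e01 fB fm g; have := kinetic_min_bound fB fm.
rewrite ler_norml => /andP[_ mB]; have [[k fk] mP] := fm.
have [|//|sm le1] := @vint_le _ dv g (expdecay dv (expR (2 * B))) dv0.
- move=> j; rewrite expR_ge0/=.
  apply: le_trans (exp_scaled_le e01 _) _; first by rewrite subr_ge0.
  apply: le_trans (_ : expR (2 * B) * expR (- (node dv j ^+ 2 / 2)) <= _).
    rewrite -expRD ler_expR; have := fB j.
    by rewrite ler_norml => /andP[h1 h2]; lra.
  by rewrite ler_wpM2l ?expR_ge0// gauss_le_expdecay.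
- by apply: esum_expdecay_lty => //; exact: expR_ge0.
split=> //; rewrite le1 andbT; have := vint_ge_node k dv0 _ sm.
rewrite [g k]/g fk subrr oppr0 mul0r expR0 mul1r; apply => j.
exact: expR_ge0.
Qed.

(** Shifting by the minimum makes one exponential equal to 1 and leaves the other
in [0, 1]. *)
Lemma softmin_arg_itv (p q x y M eps : R) :
  0 < p -> 0 < q -> 0 < eps -> M = Num.min x y ->
  Num.min p q <= p * expR (- (x - M) / eps) + q * expR (- (y - M) / eps)
              <= p + q.
Proof.
move=> p0 q0 e0 ME.
have le1 z : M <= z -> expR (- (z - M) / eps) <= 1.
  by move=> Mz; rewrite expR_le1 mulNr oppr_le0 divr_ge0 ?subr_ge0// ltW.
have /le1 Ex : M <= x by rewrite ME ge_min lexx.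
have /le1 Ey : M <= y by rewrite ME ge_min lexx orbT.
apply/andP; split; last by apply: lerD; rewrite -[leRHS]mulr1 ler_pM2l.
move: ME; case: (leP x y) => xy ->.
  rewrite subrr oppr0 mul0r expR0 mulr1 ge_min lerDl.
  by rewrite (mulr_ge0 (ltW q0)) ?expR_ge0.
rewrite subrr oppr0 mul0r expR0 mulr1 ge_min lerDr.
by rewrite (mulr_ge0 (ltW p0)) ?expR_ge0 ?orbT.
Qed.

End LogSumExp.

(** * One time step *)

Section Step.
Variable R : realType.
Variables (dt dx dv : R).
Hypotheses (dt_gt0 : 0 < dt) (dv_gt0 : 0 < dv).
Implicit Types (eps B K : R) (u w : int -> int -> R).

(** One step at one space index, for arbitrary data u: the estimates of a step
are independent of where u comes from. *)
Definition eps_step eps u (i : int) (mu1 : R) (phi1 : int -> R) : Prop :=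
  let ph j := interp dt dx dv u i j in
  let c := c_dv dv eps in
  exists m : R,
    let g j := expR (- (ph j - m) / eps) in
    [/\ is_min ph m,
        summable [set: int] (fun j => (g j * dv)%:E),
        mu1 = m - eps * ln (vint dv g) &
        forall j,
          let w := node dv j ^+ 2 / 2 + mu1 in
          let M := Num.min (ph j + dt) w in
          phi1 j =
            M - eps * ln (c * expR (- (ph j + dt - M) / eps)
                          + (1 - expR (- dt / eps)) * expR (- (w - M) / eps))
            + eps * ln c].

Definition limit_step u (i : int) (mu1 : R) (phi1 : int -> R) : Prop :=
  is_min (interp dt dx dv u i) mu1 /\
  forall j, phi1 j = Num.min (interp dt dx dv u i j + dt)
                             (node dv j ^+ 2 / 2 + mu1).

(** Consistency of one step with the limit scheme. The constant is a sum of
bounds on the three logarithms of the step: those of the integral in mu, of the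
argument in phi and of c. It depends on the data only through B. *)
Lemma eps_step_near_min B : exists2 K, 0 <= K &
  forall eps u i mu1 phi1, 0 < eps <= 1 ->
    (forall i', kinetic dv B (u i')) -> eps_step eps u i mu1 phi1 ->
    (exists2 m, is_min (interp dt dx dv u i) m & `|mu1 - m| <= K * eps) /\
    forall j, `|phi1 j - Num.min (interp dt dx dv u i j + dt)
                                 (node dv j ^+ 2 / 2 + mu1)| <= K * eps.
Proof.
pose Kmu := `|ln dv| + `|ln (vint dv (expdecay dv (expR (2 * B))))|.
pose Kc := `|ln dv| + `|ln (vint dv (expdecay dv 1))|.
pose q1 := 1 - expR (- dt).
pose Kphi := `|ln (Num.min dv q1)| + `|ln (vint dv (expdecay dv 1) + 1)|.
have Kmu0 : 0 <= Kmu by rewrite addr_ge0.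
have Kc0 : 0 <= Kc by rewrite addr_ge0.
have Kphi0 : 0 <= Kphi by rewrite addr_ge0.
exists (Kmu + Kc + Kphi); first by rewrite !addr_ge0.
move=> eps u i mu1 phi1 e01 uB [m [mmin _ mu1E phi1E]].
have /andP[e0 e1] := e01.
have phB : kinetic dv B (interp dt dx dv u i) by exact: interp_kinetic.
split.
  exists m => //; have [_ gI] := weights_itv dv_gt0 e01 phB mmin.
  rewrite mu1E addrAC subrr sub0r normrN normrM (gtr0_norm e0) mulrC.
  rewrite ler_pM2r//; apply: le_trans (norm_ln_le dv_gt0 gI) _.
  by rewrite -/Kmu; lra.
move=> j; rewrite {}phi1E.
set ph := interp dt dx dv u i j; set w := node dv j ^+ 2 / 2 + mu1.
set M := Num.min (ph + dt) w; set c := c_dv dv eps.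
set q := 1 - expR (- dt / eps).
have cI := c_dv_itv dv_gt0 e01; rewrite -/c in cI; have /andP[c1 c2] := cI.
have q10 : 0 < q1 by rewrite subr_gt0 expR_lt1 oppr_lt0.
have q1q : q1 <= q by rewrite lerD2l lerN2 exp_scaled_le// ltW.
have q0 : 0 < q by exact: lt_le_trans q1q.
have qle1 : q <= 1 by rewrite gerBl expR_ge0.
have c0 : 0 < c by exact: lt_le_trans c1.
have /andP[h1 h2] := softmin_arg_itv c0 q0 e0 (erefl M).
 set A := _ + _ in h1 h2 *.
have lnA : `|ln A| <= Kphi.
  apply: norm_ln_le; first by rewrite lt_min dv_gt0.
  apply/andP; split; last by apply: le_trans h2 _; exact: lerD.
  apply: le_trans h1; rewrite le_min !ge_min c1 q1q orbT//.
have lnc : `|ln c| <= Kc by exact: norm_ln_le cI.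
have -> : M - eps * ln A + eps * ln c - M = eps * (ln c - ln A) by ring.
rewrite normrM (gtr0_norm e0) mulrC ler_pM2r//.
by apply: le_trans (ler_normB _ _) _; lra.
Qed.

Lemma limit_step_kinetic B u i mu1 phi1 :
  (forall i', kinetic dv B (u i')) -> limit_step u i mu1 phi1 ->
  kinetic dv (B + dt) phi1.
Proof.
have dt0 := dt_gt0; move=> uB [mmin phi1E] j; rewrite {}phi1E.
have phB : kinetic dv B (interp dt dx dv u i) by exact: interp_kinetic.
have mB := kinetic_min_bound phB mmin.
move: j; apply: min_kinetic => j.
  have := phB j; rewrite !ler_norml => /andP[h1 h2].
  by apply/andP; split; lra.
by rewrite addrAC subrr add0r; apply: le_trans mB _; lra.
Qed.

Lemma eps_step_kinetic B : exists B', forall eps u i mu1 phi1, 0 < eps <= 1 ->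
    (forall i', kinetic dv B (u i')) -> eps_step eps u i mu1 phi1 ->
  kinetic dv B' phi1.
Proof.
have [K K0 KP] := eps_step_near_min B.
exists (B + dt + 2 * K) => eps u i mu1 phi1 e01 uB st.
have dt0 := dt_gt0; have /andP[e0 e1] := e01.
have [[m mmin mu1m] phi1M] := KP _ _ _ _ _ e01 uB st.
have phB : kinetic dv B (interp dt dx dv u i) by exact: interp_kinetic.
have mB := kinetic_min_bound phB mmin.
have KeK : K * eps <= K by rewrite ler_piMr.
have minB : kinetic dv (B + dt + K) (fun j =>
    Num.min (interp dt dx dv u i j + dt) (node dv j ^+ 2 / 2 + mu1)).
  apply: min_kinetic => j.
    have := phB j; rewrite !ler_norml => /andP[h1 h2].
    by apply/andP; split; lra.
  rewrite addrAC subrr add0r; have := mu1m; have := mB.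
  rewrite !ler_norml => /andP[h1 h2] /andP[h3 h4].
  by apply/andP; split; lra.
move=> j; have := minB j; have := phi1M j.
rewrite !ler_norml => /andP[h1 h2] /andP[h3 h4].
by apply/andP; split; lra.
Qed.

(** Stability and consistency combined: the distance d of the data is not
amplified, since every operation of the limit step is 1-Lipschitz. *)
Lemma step_dist B : exists2 K, 0 <= K &
  forall eps d u w i mu1 phi1 mu2 phi2, 0 < eps <= 1 ->
    (forall i', kinetic dv B (u i')) ->
    (forall i' j, `|u i' j - w i' j| <= d) ->
    eps_step eps u i mu1 phi1 -> limit_step w i mu2 phi2 ->
    `|mu1 - mu2| <= d + K * eps /\
    forall j, `|phi1 j - phi2 j| <= d + K * eps.
Proof.
have [K K0 KP] := eps_step_near_min B.
(* phi uses mu, so its error gathers that of mu and that of its own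
   logarithms. *)
exists (2 * K) => [|eps d u w i mu1 phi1 mu2 phi2]; first by rewrite mulr_ge0.
move=> e01 uB uwd st [m2min phi2E].
have [[m mmin mu1m] phi1M] := KP _ _ _ _ _ e01 uB st.
have Ke0 : 0 <= K * eps by rewrite mulr_ge0//; case/andP: e01 => /ltW.
have md : `|m - mu2| <= d.
  by apply: is_min_dist mmin m2min _ => j; exact: interp_dist.
have mud : `|mu1 - mu2| <= d + K * eps.
  move: mu1m md; rewrite !ler_norml => /andP[h1 h2] /andP[h3 h4].
  by apply/andP; split; lra.
split; first by apply: le_trans mud _; lra.
move=> j; rewrite phi2E.
have Md : `|Num.min (interp dt dx dv u i j + dt) (node dv j ^+ 2 / 2 + mu1) -
    Num.min (interp dt dx dv w i j + dt) (node dv j ^+ 2 / 2 + mu2)|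
    <= d + K * eps.
  apply: min_dist; last by rewrite opprD addrACA subrr add0r.
  rewrite opprD addrACA subrr addr0.
  by apply: le_trans (interp_dist _ _ _ _ _ uwd) _; lra.
move: Md (phi1M j); rewrite !ler_norml => /andP[h1 h2] /andP[h3 h4].
by apply/andP; split; lra.
Qed.

End Step.

(** * The scheme as a program and its cost *)

Section Procedure.

Definition interp_expr : expr :=
  OpAdd (OpMul (OpSub (Lit 1) Frac) Foot) (OpMul Frac FootL).

Definition gibbs_expr (a : expr) : expr := OpExp (OpDiv (OpSub (Lit 0) a) Eps).

Definition kinetic_expr : expr := OpDiv (OpMul Vel Vel) (Lit 2).

Definition mass_expr : expr :=
  SumV (OpExp (OpSub (Lit 0) (OpDiv (OpMul Vel Vel) (OpMul (Lit 2) Eps)))).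

Definition mu_body : expr :=
  OpSub (Var 0)
    (OpMul Eps (OpLn (SumV (gibbs_expr (OpSub interp_expr (Var 0)))))).

Definition mu_expr : expr := Let (MinV interp_expr) mu_body.

(** Var 0, Var 1 and Var 2 stand for c, M and w = v_j^2/2 + mu, in the order
opposite to that in which the enclosing program binds them. *)
Definition phi_body : expr :=
  OpAdd
    (OpSub (Var 1)
       (OpMul Eps (OpLn (OpAdd
          (OpMul (Var 0)
             (gibbs_expr (OpSub (OpAdd interp_expr TimeStep) (Var 1))))
          (OpMul (OpSub (Lit 1) (gibbs_expr TimeStep))
             (gibbs_expr (OpSub (Var 2) (Var 1))))))))
    (OpMul Eps (OpLn (Var 0))).

Definition phi_expr : expr :=
  Let (OpAdd kinetic_expr (Var 0))
    (Let (OpMin (OpAdd interp_expr TimeStep) (Var 0))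
       (Let mass_expr phi_body)).

Definition scheme_procedure := Procedure mu_expr phi_expr.

(** The cost read off the syntax, N being the number of velocity nodes; it
agrees with the run-time cost on loop-free programs only. *)
Fixpoint static_cost (N : nat) (e : expr) : nat :=
  match e with
  | OpAdd a b | OpSub a b | OpMul a b | OpDiv a b | OpMin a b | Let a b =>
      (static_cost N a + static_cost N b).+1
  | OpExp a | OpLn a => (static_cost N a).+1
  | MinV a | SumV a => (N * (static_cost N a).+1)%N
  | _ => 1
  end.

Variable R : realType.
Implicit Types (dt dx dv eps : R) (u : int -> int -> R).

Lemma run_cost_loop_free dt dx dv eps u i (J : seq int) e j s :
  loop_free e ->
  run_cost dt dx dv eps u i J e j s = static_cost (size J) e.
Proof.
elim: e j s => //=;
  try by move=> a IHa b IHb j s /andP[la lb]; rewrite IHa// IHb.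
- by move=> a IHa j s la; rewrite IHa.
- by move=> a IHa j s la; rewrite IHa.
- move=> a IHa j s la; under eq_bigr do rewrite IHa//.
  by rewrite big_const_seq count_predT iter_addn_0 mulnC.
- move=> a IHa j s la; under eq_bigr do rewrite IHa//.
  by rewrite big_const_seq count_predT iter_addn_0 mulnC.
Qed.

Lemma run_mass dt dx dv eps u i j s :
  run dt dx dv eps u i mass_expr j s = c_dv dv eps.
Proof. by rewrite /= /c_dv; congr vint; apply/funext => k; rewrite sub0r. Qed.

Lemma run_mu dt dx dv eps u i m j s : is_min (interp dt dx dv u i) m ->
  run dt dx dv eps u i mu_expr j s =
  m - eps * ln (vint dv (fun k =>
    expR (- (interp dt dx dv u i k - m) / eps))).
Proof.
move=> mmin.
have E : run dt dx dv eps u i (MinV interp_expr) j s = m.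
  exact: is_min_inf.
transitivity (run dt dx dv eps u i mu_body j (m :: s)); first by rewrite -{1}E.
rewrite /=; congr (_ - _ * ln (vint _ _)); apply/funext => k.
by rewrite sub0r.
Qed.

Lemma run_phi dt dx dv eps u i mu j s :
  let ph := interp dt dx dv u i j in
  let c := c_dv dv eps in
  let w := node dv j ^+ 2 / 2 + mu in
  let M := Num.min (ph + dt) w in
  run dt dx dv eps u i phi_expr j (mu :: s) =
  M - eps * ln (c * expR (- (ph + dt - M) / eps)
                + (1 - expR (- dt / eps)) * expR (- (w - M) / eps))
    + eps * ln c.
Proof.
move=> ph c w M; have := run_mass dt dx dv eps u i j (M :: w :: mu :: s).
rewrite -/c => massE.
transitivity (run dt dx dv eps u i (Let mass_expr phi_body) j
  (M :: w :: mu :: s)); first by [].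
transitivity (run dt dx dv eps u i phi_body j (c :: M :: w :: mu :: s)).
  by rewrite -{1}massE.
by rewrite /= !sub0r.
Qed.

Lemma eps_step_run dt dx dv eps u i mu1 phi1 :
  eps_step dt dx dv eps u i mu1 phi1 ->
  mu1 = run dt dx dv eps u i mu_expr 0 [::] /\
  forall j, phi1 j = run dt dx dv eps u i phi_expr j [:: mu1].
Proof.
move=> [m [mmin _ mu1E phi1E]]; split; first by rewrite (run_mu _ _ _ mmin).
by move=> j; rewrite run_phi phi1E.
Qed.

(** Running the program on kinetic data performs a step of the scheme: the
minimum is attained and the series converges, so that the infimum and the
integral computed by the program are the ones that the scheme asks for. *)
Lemma run_eps_step dt dx dv eps B u i : 0 < dv -> 0 < eps <= 1 ->
  (forall i', kinetic dv B (u i')) ->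
  let mu1 := run dt dx dv eps u i mu_expr 0 [::] in
  eps_step dt dx dv eps u i mu1
    (fun j => run dt dx dv eps u i phi_expr j [:: mu1]).
Proof.
move=> dv0 e01 uB mu1.
have phB : kinetic dv B (interp dt dx dv u i) by exact: interp_kinetic.
have [m mmin] := kinetic_min dv0 phB; exists m => g; split => //.
- by have [] := weights_itv dv0 e01 phB mmin.
- exact: run_mu.
- by move=> j w M; rewrite run_phi.
Qed.

End Procedure.

(** * Convergence *)

Section Solutions.
Variable R : realType.
Variables (Nt : nat) (dt dx dv : R) (phi_in : R -> R -> R) (mu_in : int -> R).
Variable M : R.
Hypotheses (dt_gt0 : 0 < dt) (dv_gt0 : 0 < dv).
Hypothesis hyp_a : forall x v : R, `|phi_in x v - v ^+ 2 / 2| <= M.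

Let Seps := eps_solution Nt dt dx dv phi_in mu_in.
Let S0 := limit_solution Nt dt dx dv phi_in mu_in.

Lemma sampled_kinetic i : kinetic dv M (sampled dx dv phi_in i).
Proof. by move=> j; exact: hyp_a. Qed.

(** B is chosen before eps: this uniformity is what makes the constants of the
single steps independent of eps. *)
Lemma eps_solution_kinetic n : (n <= Nt)%N -> exists B, forall eps mu phi,
  0 < eps <= 1 -> Seps eps mu phi -> forall i, kinetic dv B (phi n i).
Proof.
elim: n => [_|n IHn nNt].
  exists M => eps mu phi _ [_ phi0 _] i j; rewrite phi0; exact: sampled_kinetic.
have [B BP] := IHn (ltnW nNt).
have [B' B'P] := eps_step_kinetic dx dt_gt0 dv_gt0 B.
exists B' => eps mu phi e01 S i; have [_ _ step] := S.
apply: (B'P eps (phi n) i (mu n.+1 i)) => //; first exact: BP e01 S.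
exact: step.
Qed.

(** Each step adds its own constant to the one inherited from the previous
iterate; no dependence on the grid indices ever enters. *)
Lemma eps_limit_dist n : (n <= Nt)%N -> exists2 K, 0 <= K &
  forall eps mu phi mu0 phi0, 0 < eps <= 1 -> Seps eps mu phi -> S0 mu0 phi0 ->
  (forall i, `|mu n i - mu0 n i| <= K * eps) /\
  (forall i j, `|phi n i j - phi0 n i j| <= K * eps).
Proof.
elim: n => [_|n IHn nNt].
  exists 0 => // eps mu phi mu0 phi0 _ [mu_0 phi_0 _] [mu0_0 phi0_0 _].
  by split=> [i|i j]; rewrite ?mu_0 ?mu0_0 ?phi_0 ?phi0_0 subrr normr0 mul0r.
have [K K0 KP] := IHn (ltnW nNt).
have [B BP] := eps_solution_kinetic (ltnW nNt).
have [K' K'0 K'P] := step_dist dx dt_gt0 dv_gt0 B.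
exists (K + K') => [|eps mu phi mu0 phi0 e01 Se Sl]; first exact: addr_ge0.
have [_ _ step] := Se; have [_ _ step0] := Sl.
have st i := K'P eps _ (phi n) _ i _ _ _ _ e01 (BP _ _ _ e01 Se)
  (KP _ _ _ _ _ e01 Se Sl).2 (step n i nNt) (step0 n i nNt).
split=> [i|i j]; rewrite mulrDl; first exact: (st i).1.
exact: (st i).2.
Qed.

(** The solution is produced by iterating the program itself. *)
Lemma eps_solution_exists eps : 0 < eps <= 1 -> exists mu phi, Seps eps mu phi.
Proof.
move=> e01.
pose F (u : int -> int -> R) i := run dt dx dv eps u i mu_expr 0 [::].
pose G (u : int -> int -> R) i j :=
  run dt dx dv eps u i phi_expr j [:: F u i].
pose phi n := iter n G (sampled dx dv phi_in).
pose mu n := if n is n'.+1 then F (phi n') else mu_in.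
have phiB n : exists B, forall i, kinetic dv B (phi n i).
  elim: n => [|n [B BP]]; first by exists M => i; exact: sampled_kinetic.
  have [B' B'P] := eps_step_kinetic dx dt_gt0 dv_gt0 B.
  exists B' => i; apply: (B'P eps (phi n) i (F (phi n) i)) => //.
  exact: run_eps_step BP.
exists mu, phi; split=> // n i _; have [B BP] := phiB n.
exact: run_eps_step BP.
Qed.

Lemma limit_solution_exists : exists mu phi, S0 mu phi.
Proof.
pose F (u : int -> int -> R) i := inf (range (interp dt dx dv u i)).
pose G (u : int -> int -> R) i j :=
  Num.min (interp dt dx dv u i j + dt) (node dv j ^+ 2 / 2 + F u i).
pose phi n := iter n G (sampled dx dv phi_in).
pose mu n := if n is n'.+1 then F (phi n') else mu_in.
have step B u i : (forall i', kinetic dv B (u i')) ->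
    limit_step dt dx dv u i (F u i) (G u i).
  move=> uB; have [m mmin] := kinetic_min dv_gt0 (interp_kinetic dt dx i uB).
  by split=> //; rewrite /F (is_min_inf mmin).
have phiB n : exists B, forall i, kinetic dv B (phi n i).
  elim: n => [|n [B BP]]; first by exists M => i; exact: sampled_kinetic.
  exists (B + dt) => i; exact: limit_step_kinetic BP (step _ _ i BP).
exists mu, phi; split=> // n i _; have [B BP] := phiB n.
exact: step BP.
Qed.

End Solutions.

Lemma dist_cvg_locally_uniformly (R : realType) (u : R -> int -> R)
    (l : int -> R) (K : R) : 0 <= K ->
  (forall eps i, 0 < eps <= 1 -> `|u eps i - l i| <= K * eps) ->
  cvg_locally_uniformly u l.
Proof.
move=> K0 uK a b P /uniform_nbhs[E [entE EP]].
move: entE; rewrite -entourage_from_ballE => -[r /= r0 rE].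
have K1 : 0 < K + 1 by rewrite ltr_wpDl.
near=> eps; apply: EP => i _; apply: rE => /=; rewrite /ball/= distrC.
have e0 : 0 < eps by near: eps; exact: nbhs_right_gt.
have e1 : eps <= 1 by near: eps; exact: nbhs_right_le.
have er : eps < r / (K + 1).
  by near: eps; apply: nbhs_right_lt; rewrite divr_gt0.
apply: le_lt_trans (uK eps i _) _; first by rewrite e0.
by move: er; rewrite ltr_pdivlMr// => er; nra.
Unshelve. all: by end_near. Qed.

Theorem theorem2p1 (R : realType) (T : R) (Nt : nat) (dt dx dv : R)
    (T_gt0 : 0 < T) (Nt_gt0 : (0 < Nt)%N) (dtE : dt = T / Nt%:R)
    (dt_gt0 : 0 < dt) (dx_gt0 : 0 < dx) (dv_gt0 : 0 < dv)
    (phi_in : R -> R -> R) (mu_in : int -> R)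
    (mu_inE : forall i,
       is_min (interp dt dx dv (sampled dx dv phi_in) i) (mu_in i))
    (M L : R) (M_gt0 : 0 < M) (L_ge0 : 0 <= L)
    (hyp_a : forall x v : R, `|phi_in x v - v ^+ 2 / 2| <= M)
    (hyp_b : forall (i : int) (eps : R), 0 < eps <= 1 ->
       `|mu_in i + eps * ln (c_dv dv eps)| <= M)
    (hyp_c : forall v : R,
       L.-lipschitz (fun x : R => phi_in x v - v ^+ 2 / 2)) :
  let Seps := eps_solution Nt dt dx dv phi_in mu_in in
  let S0 := limit_solution Nt dt dx dv phi_in mu_in in
  [/\ (* both schemes have a solution *)
      (forall eps : R, 0 < eps <= 1 -> exists mu phi, Seps eps mu phi) /\
      (exists mu phi, S0 mu phi),
      (* convergence *)
      forall (mu : R -> nat -> int -> R) (phi : R -> nat -> int -> int -> R)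
             (mu0 : nat -> int -> R) (phi0 : nat -> int -> int -> R),
        (forall eps : R, 0 < eps <= 1 -> Seps eps (mu eps) (phi eps)) ->
        S0 mu0 phi0 ->
        forall (n : nat) (j : int), (1 <= n <= Nt)%N ->
          cvg_locally_uniformly (fun eps i => mu eps n i) (mu0 n) /\
          cvg_locally_uniformly (fun eps i => phi eps n i j)
                                (fun i => phi0 n i j) &
      (* cost *)
      exists (p : procedure) (C : nat -> nat -> nat), explicit_procedure p /\
        forall (eps : R) (mu : nat -> int -> R) (phi : nat -> int -> int -> R),
          0 < eps <= 1 -> Seps eps mu phi ->
          computes p Nt dt dx dv eps mu phi /\
          forall I J : seq int,
            total_cost p Nt dt dx dv eps mu phi I J = C (size I) (size J)].
Proof.
move=> Seps S0; split.
- split; first by move=> eps; exact: eps_solution_exists.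
  exact: limit_solution_exists.
- move=> mu phi mu0 phi0 Se Sl n j /andP[_ nNt].
  have [K K0 KP] := eps_limit_dist dx mu_in dt_gt0 dv_gt0 hyp_a nNt.
  split; apply: (dist_cvg_locally_uniformly K0) => eps i e01;
    have [muK phiK] := KP _ _ _ _ _ e01 (Se _ e01) Sl.
    exact: muK.
  exact: phiK.
- exists scheme_procedure, (fun a b => Nt * (a * (static_cost b mu_expr +
    b * static_cost b phi_expr)))%N.
  split=> // eps mu phi e01 [_ _ step]; split=> [n i nNt|I J].
    exact: eps_step_run (step n i nNt).
  rewrite /total_cost.
  under eq_bigr do under eq_bigr do (rewrite run_cost_loop_free//;
    under eq_bigr do rewrite run_cost_loop_free//;
    rewrite big_const_seq count_predT iter_addn_0).
  under eq_bigr do rewrite big_const_seq count_predT iter_addn_0.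
  by rewrite sum_nat_const card_ord; congr (_ * _)%N; rewrite mulnC;
    congr (_ * (_ + _))%N; rewrite mulnC.
Qed.
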